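(* Let $\mathbb S$ be a tensor-product generalized spline space whose local spaces $\mathbb U_c$, $c\in\mathrm G$, are (tensor products of univariate) ECT-spaces, i.e. each $\mathbb U^j_i$ is an ECT-space of dimension $p_j+1$ on $I^j_i$. Then the extension assumption holds for $\mathbb S$: for any two distinct cells $c,c'\in\mathrm G$ with $c\cap c'\neq\emptyset$ and any $u_c\in\mathbb U_c$, $u_{c'}\in\mathbb U_{c'}$ with $u_c\sim u_{c'}$, there exists a spline $s\in\mathbb S$ such that $s_c=u_c$ and $s_{c'}=u_{c'}$.
   Context: **ECT-spaces.** A $(p+1)$-dimensional subspace of $C^p(I)$, $I$ an interval, is an ET-space on $I$ if every Hermite interpolation problem with $p+1$ data points in $I$, counting multiplicities, is unisolvent. A $(p+1)$-dimensional subspace $\mathbb U\subseteq C^p(I)$ is an ECT-space if it has a basis $u_0,\dots,u_p$ such that $\operatorname{span}\{u_0,\dots,u_k\}$ is an ET-space on $I$ for all $k=0,\dots,p$. **Univariate spaces.** Let $T=\{t_i\}_{i=1}^n$ be strictly increasing interior points of $[a,b]$, $t_0=a$, $t_{n+1}=b$, $I_i=[t_i,t_{i+1}]$. For each $i=0,\dots,n$ let $\mathbb U_i=\operatorname{span}\{u_{i,j}\}_{j=0}^p\subseteq C^p(I_i)$, $p\ge 1$ an integer, and let $\mathbf r=(r_1,\dots,r_n)$ be integers with $0\le r_i\le p$. The generalized spline space $\mathbb S(\{\mathbb U_i\},T,\mathbf r)$ is the set of $(s_0,\dots,s_n)$ with $s_i\in\mathbb U_i$ and $D^ks_{i-1}(t_i)=D^ks_i(t_i)$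 for $i=1,\dots,n$, $k=0,\dots,r_i$. **Tensor-product spaces.** On a box $[a_1,b_1]\times\dots\times[a_d,b_d]$, given such univariate data in each direction $j=1,\dots,d$ (points $t^j_i$, $i=0,\dots,n_j+1$, intervals $I^j_i$, integer $p_j\ge1$, spaces $\mathbb U^j_i$, orders $r^j_i$), the tensor-product generalized spline space is $\mathbb S=\bigotimes_{j=1}^d\mathbb S(\{\mathbb U^j_i\},T^j,\mathbf r^j)$. The cells are the boxes $c=I^1_{i_1}\times\dots\times I^d_{i_d}$; $\mathrm G$ is the set of all cells; $\mathbb U_c=\bigotimes_j\mathbb U^j_{i_j}$. An element $s\in\mathbb S$ is identified with the family of its pieces $s_c=s|_c\in\mathbb U_c$. **Contact.** Let $c\ne c'$ be cells with $\tau=c\cap c'\neq\emptyset$, $\tau=\prod_j[t^j_{i_1},t^j_{i_2}]$ with $i_2\in\{i_1,i_1+1\}$ (indices depending on $j$). Then $s_c\in\mathbb U_c$ and $s_{c'}\in\mathbb U_{c'}$ have contact, $s_c\sim s_{c'}$, if $\partial_{x_1}^{k_1}\cdots\partial_{x_d}^{k_d}s_c=\partial_{x_1}^{k_1}\cdots\partial_{x_d}^{k_d}s_{c'}$ at every point of $\tau$ for all $(k_1,\dots,k_d)$ with $0\le k_j\le\max(r^j_{i_1},r^j_{i_2})$ for each $j$ (convention: $r^j_0=r^j_{n_j+1}=0$). *)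

(* Defs.v *)
From HB Require Import structures.
From mathcomp Require Import all_boot all_order all_algebra.
From mathcomp Require Import all_classical all_reals all_analysis.

Set Implicit Arguments.
Unset Strict Implicit.
Unset Printing Implicit Defensive.

Import Order.TTheory GRing.Theory Num.Theory.
Import numFieldNormedType.Exports.

Local Open Scope classical_set_scope.
Local Open Scope ring_scope.

(* Functions on a subset A of R or R^d are represented by total functions of
   which only the values on A matter: two of them are identified when they
   agree on A, and all sets of functions below are saturated for this
   relation. *)

(* The library's [derivable] and [derive], with the increment h restricted so
   that h *: v + a stays in A; at an endpoint of an interval this is the
   one-sided derivative. *)
Definition derivable_in (R : realType) (V : normedModType R) (A : set V)
    (f : V -> R) (a v : V) : Prop :=
  cvg ((fun h : R => h^-1 *: (f (h *: v + a) - f a))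
         @ within [set h : R | A (h *: v + a)] 0^').

Definition derive_in (R : realType) (V : normedModType R) (A : set V)
    (f : V -> R) (a v : V) : R :=
  lim ((fun h : R => h^-1 *: (f (h *: v + a) - f a))
         @ within [set h : R | A (h *: v + a)] 0^').

Definition deriven_in (R : realType) (A : set R) (k : nat) (f : R -> R) :
    R -> R :=
  iter k (fun g x => derive_in A g x 1) f.

Definition Cp (R : realType) (p : nat) (A : set R) : set (R -> R) :=
  [set f | (forall k x, (k < p)%N -> A x ->
              derivable_in A (deriven_in A k f) x 1) /\
           {within A, continuous (deriven_in A p f)}].

Definition span_on (R : realType) (A : set R) (m : nat)
    (u : 'I_m -> R -> R) : set (R -> R) :=
  [set f | exists a : 'I_m -> R, forall x, A x -> f x = \sum_i a i * u i x].

Definition free_on (R : realType) (A : set R) (m : nat)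
    (u : 'I_m -> R -> R) : Prop :=
  forall a : 'I_m -> R, (forall x, A x -> \sum_i a i * u i x = 0) ->
  forall i, a i = 0.

Definition basis_on (R : realType) (A : set R) (V : set (R -> R)) (m : nat)
    (u : 'I_m -> R -> R) : Prop :=
  V = span_on A u /\ free_on A u.

Definition has_dim_on (R : realType) (A : set R) (V : set (R -> R))
    (m : nat) : Prop :=
  exists u : 'I_m -> R -> R, basis_on A V u.

(* A Hermite problem: distinct nodes [x i] of multiplicity [mu i] and data
   [y i l], of which only the entries with l < mu i are used. *)
Definition hermite_solution (R : realType) (A : set R) (m : nat)
    (x : 'I_m -> R) (mu : 'I_m -> nat) (y : 'I_m -> nat -> R)
    (f : R -> R) : Prop :=
  forall i l, (l < mu i)%N -> deriven_in A l f (x i) = y i l.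

Definition hermite_unisolvent (R : realType) (A : set R) (V : set (R -> R))
    (N : nat) : Prop :=
  forall (m : nat) (x : 'I_m -> R) (mu : 'I_m -> nat) (y : 'I_m -> nat -> R),
    injective x -> (forall i, A (x i)) -> (forall i, (0 < mu i)%N) ->
    (\sum_i mu i = N)%N ->
    exists f, [/\ V f, hermite_solution A x mu y f &
      forall g, V g -> hermite_solution A x mu y g ->
        forall z, A z -> g z = f z].

Definition ET_space (R : realType) (p : nat) (A : set R)
    (V : set (R -> R)) : Prop :=
  [/\ has_dim_on A V p.+1, V `<=` Cp p A & hermite_unisolvent A V p.+1].

Definition ECT_space (R : realType) (p : nat) (A : set R)
    (V : set (R -> R)) : Prop :=
  V `<=` Cp p A /\
  exists u : 'I_p.+1 -> R -> R, basis_on A V u /\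
    forall k : 'I_p.+1,
      ET_space k A (span_on A (fun j : 'I_k.+1 => u (widen_ord (ltn_ord k) j))).

(* [knot 0] and [knot nknots.+1] are the endpoints a and b.  Only the values
   [knot i] for i <= nknots.+1, [gen i] for i <= nknots and [smoothness i] for
   1 <= i <= nknots are meaningful. *)
Record univariate_data (R : realType) := UnivariateData {
  nknots : nat;
  degree : nat;
  knot : nat -> R;
  gen : nat -> 'I_degree.+1 -> R -> R;
  smoothness : nat -> nat;
  degree_gt0 : (0 < degree)%N;
  knot_lt : forall i, (i <= nknots)%N -> knot i < knot i.+1;
  gen_Cp : forall i j, (i <= nknots)%N ->
    Cp degree `[knot i, knot i.+1] (gen i j);
  smoothness_le : forall i, (1 <= i <= nknots)%N -> (smoothness i <= degree)%N }.

Definition itvl (R : realType) (D : univariate_data R) (i : nat) : set R :=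
  `[knot D i, knot D i.+1].

Definition local_space (R : realType) (D : univariate_data R) (i : nat) :
    set (R -> R) :=
  span_on (itvl D i) (@gen R D i).

(* Only the pieces [s i] with i <= nknots D are meaningful. *)
Definition spline1 (R : realType) (D : univariate_data R) :
    set (nat -> R -> R) :=
  [set s | (forall i, (i <= nknots D)%N -> local_space D i (s i)) /\
    forall i k, (1 <= i <= nknots D)%N -> (k <= smoothness D i)%N ->
      deriven_in (itvl D i.-1) k (s i.-1) (knot D i) =
      deriven_in (itvl D i) k (s i) (knot D i)].

(* Cells are given by their indices (i_1, ..., i_d). *)
Definition cell (R : realType) (d : nat) (D : 'I_d -> univariate_data R) :=
  forall j : 'I_d, 'I_(nknots (D j)).+1.

Definition box (R : realType) (d : nat) (D : 'I_d -> univariate_data R)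
    (c : cell D) : set 'rV[R]_d :=
  [set x | forall j, itvl (D j) (c j) (x ord0 j)].

(* Tensor products of function spaces are realized as the sets of finite sums
   of products w_1(x_1) ... w_d(x_d) with w_j in the j-th factor. *)
Definition cell_space (R : realType) (d : nat) (D : 'I_d -> univariate_data R)
    (c : cell D) : set ('rV[R]_d -> R) :=
  [set f | exists (m : nat) (w : 'I_m -> 'I_d -> R -> R),
    (forall k j, local_space (D j) (c j) (w k j)) /\
    forall x, box c x -> f x = \sum_k \prod_j w k j (x ord0 j)].

Definition tensor_spline (R : realType) (d : nat)
    (D : 'I_d -> univariate_data R) : set (cell D -> 'rV[R]_d -> R) :=
  [set s | exists (m : nat) (w : 'I_m -> 'I_d -> nat -> R -> R),
    (forall k j, spline1 (D j) (w k j)) /\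
    forall c x, box c x -> s c x = \sum_k \prod_j w k j (c j) (x ord0 j)].

Definition partial_in (R : realType) (d : nat) (A : set 'rV[R]_d)
    (j : 'I_d) (f : 'rV[R]_d -> R) : 'rV[R]_d -> R :=
  fun x => derive_in A f x (delta_mx ord0 j).

Definition mpartial_in (R : realType) (d : nat) (A : set 'rV[R]_d)
    (k : 'I_d -> nat) (f : 'rV[R]_d -> R) : 'rV[R]_d -> R :=
  foldr (fun j g => iter (k j) (partial_in A j) g) f (enum 'I_d).

Definition smoothness0 (R : realType) (D : univariate_data R) (i : nat) : nat :=
  if (1 <= i <= nknots D)%N then smoothness D i else 0%N.

(* When the cells meet, the j-th factor of their intersection is
   [t_i1, t_i2] with i1 = max (c j) (c' j) and i2 = (min (c j) (c' j)).+1. *)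
Definition contact (R : realType) (d : nat) (D : 'I_d -> univariate_data R)
    (c c' : cell D) (f f' : 'rV[R]_d -> R) : Prop :=
  forall k : 'I_d -> nat,
    (forall j, (k j <= maxn (smoothness0 (D j) (maxn (c j) (c' j)))
                            (smoothness0 (D j) (minn (c j) (c' j)).+1))%N) ->
    forall x, (box c `&` box c') x ->
      mpartial_in (box c) k f x = mpartial_in (box c') k f' x.

(* Main.v *)
Require Import Defs.
From mathcomp Require Import all_boot all_order all_algebra.
From mathcomp Require Import all_classical all_reals all_analysis.
From mathcomp Require Import zify lra.

Set Implicit Arguments.
Unset Strict Implicit.
Unset Printing Implicit Defensive.

Import Order.TTheory GRing.Theory Num.Theory.
Import numFieldNormedType.Exports.

Local Open Scope classical_set_scope.
Local Open Scope ring_scope.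

(** The construction is univariate and is then multiplied out.  Fix a direction
    and let i, i' be the indices of c, c' there.  The derivatives up to order p
    at one point can be prescribed freely in an ECT-space of dimension p+1, so a
    piece on one cell, or a contact pair of pieces on two adjacent cells,
    extends cell by cell to a spline on the whole interval ([extend_spline]).
    If i and i' are adjacent with common knot tau and smoothness r, let T f, for
    a piece f on either cell, be the element of the space on cell i' with the
    derivatives of f at tau up to order r and with vanishing derivatives of
    orders r+1, ..., p; if i = i', let T f be f.  In both cases
      T f (t) = sum_(l <= N) f^(l)(node t) E_l(t),
    with node t = tau in the first case and, in the second, N = 0, node t = t
    and E_0 = 1.  Then
    ([cell_pair_extension]) there are splines
    - Z f with pieces f on cell i and T f on cell i', for f on cell i;
    - X g and Y g with pieces g and T g on cell i', and with the same piece on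
      cell i, for g on cell i'.

    Write u and u' as sums of products prod_j f_(k,j) and prod_j g_(k,j), and
    put
      s = sum_k prod_j Z f_(k,j)
          + (sum_k prod_j X g_(k,j) - sum_k prod_j Y g_(k,j)).
    On c the last two sums cancel and s = u.  On c' one finds
      s = u' + (sum_k prod_j T f_(k,j) - sum_k prod_j T g_(k,j)).
    Multiplying out the products of finite sums ([eq_sum_prod_sum]), each of the
    two sums in the bracket becomes a combination, with coefficients
    prod_j E_(j,l_j), of the mixed partial derivatives of order (l_1, ..., l_d)
    of u, respectively u', at the point with coordinates node x_j
    ([mpartial_in_tensor]).  That point lies in both cells and the orders are
    among those of the contact condition, so the bracket vanishes. *)

(** * Derivatives relative to a set *)

Lemma fmap_near_eq (T U : Type) (F : set_system T) (FF : Filter F)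
    (f g : T -> U) : {near F, f =1 g} -> f @ F = g @ F.
Proof.
move=> fg; have gf : {near F, g =1 f} by apply: filterS fg => x /esym.
by rewrite eqEsubset; split; [exact: (near_eq_cvg fg)|exact: (near_eq_cvg gf)].
Qed.

(** The derivative sees only the increments that stay in the set.  Both the
    dependence on the values in the set alone and the reduction of a partial
    derivative on a box to a derivative on an interval are instances. *)
Lemma quotient_transfer (R : realType) (V W : normedModType R)
    (A : set V) (B : set W) (f : V -> R) (g : W -> R)
    (a v : V) (b w : W) :
  (forall h, A (h *: v + a) <-> B (h *: w + b)) ->
  (forall h, A (h *: v + a) -> f (h *: v + a) = g (h *: w + b)) ->
  f a = g b ->
  (fun h : R => h^-1 *: (f (h *: v + a) - f a))
         @ within [set h : R | A (h *: v + a)] 0^' =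
  (fun h : R => h^-1 *: (g (h *: w + b) - g b))
         @ within [set h : R | B (h *: w + b)] 0^'.
Proof.
move=> AB fg fga.
have <- : [set h : R | A (h *: v + a)] = [set h : R | B (h *: w + b)].
  by apply/seteqP; split => h /AB.
apply: fmap_near_eq; rewrite near_withinE; near=> h => Ah /=.
by rewrite fg // fga.
Unshelve. all: by end_near. Qed.

Lemma derive_in_transfer (R : realType) (V W : normedModType R)
    (A : set V) (B : set W) (f : V -> R) (g : W -> R)
    (a v : V) (b w : W) :
  (forall h, A (h *: v + a) <-> B (h *: w + b)) ->
  (forall h, A (h *: v + a) -> f (h *: v + a) = g (h *: w + b)) ->
  f a = g b -> derive_in A f a v = derive_in B g b w.
Proof.
by move=> AB fg fga; rewrite /derive_in (quotient_transfer AB fg fga).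
Qed.

Section OneDim.
Variables (R : realType) (s t : R).
Hypothesis st : s < t.
Let A : set R := `[s, t].

(** Limits along this filter are unique because the interval is nondegenerate;
    at the right endpoint the increments are negative. *)
Lemma increments_proper a : A a ->
  ProperFilter (within [set h : R | A (h *: (1 : R) + a)] 0^').
Proof.
move=> /=; rewrite /A /= in_itv /= => /andP[sa at_].
apply: Build_ProperFilter => //=; rewrite /within /dnbhs /within /=.
move/nbhs_ballP => [e /= e0] H.
have [lt_at|] := ltP a t.
  pose h := Num.min (e / 2) (t - a).
  have h0 : 0 < h by rewrite lt_min subr_gt0 lt_at andbT divr_gt0.
  have he : h <= e / 2 by rewrite ge_min lexx.
  have ht : h <= t - a by rewrite ge_min lexx orbT.
  apply: (H h); first by rewrite /ball /= sub0r normrN gtr0_norm //; lra.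
    by rewrite gt_eqF.
  by rewrite /= in_itv /= /GRing.scale /= mulr1; apply/andP; split; lra.
move=> ta; have sa0 : 0 < a - s by rewrite subr_gt0 (lt_le_trans st).
pose h := Num.min (e / 2) (a - s).
have h0 : 0 < h by rewrite lt_min divr_gt0.
have he : h <= e / 2 by rewrite ge_min lexx.
have ht : h <= a - s by rewrite ge_min lexx orbT.
apply: (H (- h)).
- by rewrite /ball /= sub0r opprK gtr0_norm //; lra.
- by rewrite oppr_eq0 gt_eqF.
- by rewrite /= in_itv /= /GRing.scale /= mulr1; apply/andP; split; lra.
Qed.

Lemma derive_in_sum (I : finType) (b : I -> R) (f : I -> R -> R) (g : R -> R)
    (a : R) :
  A a -> (forall x, A x -> g x = \sum_i b i * f i x) ->
  (forall i, derivable_in A (f i) a 1) ->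
  derive_in A g a 1 = \sum_i b i * derive_in A (f i) a 1.
Proof.
move=> Aa gE fd.
have PF := increments_proper Aa.
rewrite (@derive_in_transfer _ _ _ A A g (fun x => \sum_i b i * f i x) a 1 a 1) //;
  [|by move=> h /gE|exact: gE].
rewrite /derive_in; apply: cvg_lim => //.
under eq_fun => h.
  rewrite -sumrB scaler_sumr.
  under eq_bigr => i _ do rewrite -mulrBr /GRing.scale /= mulrCA.
  over.
by apply: (cvg_big add_continuous) => i _; apply: cvgMl_tmp; exact: fd.
Qed.

(** Linearity holds only up to the order of differentiability: beyond it the
    derivative is the default value of a limit. *)
Lemma deriven_in_sum p (I : finType) (b : I -> R) (f : I -> R -> R)
    (g : R -> R) k a :
  (k <= p)%N -> A a -> (forall x, A x -> g x = \sum_i b i * f i x) ->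
  (forall i, Cp p A (f i)) ->
  deriven_in A k g a = \sum_i b i * deriven_in A k (f i) a.
Proof.
move=> + + gE fCp; elim: k a => [|k IH] a kp Aa; first exact: gE.
rewrite /deriven_in !iterS -/(deriven_in A k g).
apply: derive_in_sum => // [x Ax|i]; first by apply: IH => //; exact: ltnW.
by case: (fCp i) => + _; apply.
Qed.

End OneDim.
(** * Extension of univariate splines *)

Section Univariate.
Variables (R : realType) (D : univariate_data R).
Local Notation n := (nknots D).
Local Notation p := (degree D).
Hypothesis hECT : forall i, (i <= n)%N -> ECT_space p (itvl D i) (local_space D i).

Lemma itvl_left i : (i <= n)%N -> itvl D i (knot D i).
Proof. by move=> ile; rewrite /itvl /= in_itv /= lexx /= ltW ?knot_lt. Qed.

Lemma itvl_right i : (i <= n)%N -> itvl D i (knot D i.+1).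
Proof. by move=> ile; rewrite /itvl /= in_itv /= lexx andbT ltW ?knot_lt. Qed.

Lemma local_space_sum i (I : finType) (b : I -> R) (f : I -> R -> R) :
  (forall k, local_space D i (f k)) ->
  local_space D i (fun x => \sum_k b k * f k x).
Proof.
move=> /choice[a fE]; exists (fun l => \sum_k b k * a k l) => x Ax.
under eq_bigr => k _ do rewrite fE // mulr_sumr.
rewrite exchange_big; apply: eq_bigr => l _ /=.
by rewrite mulr_suml; apply: eq_bigr => k _; rewrite mulrA.
Qed.

Lemma local_space_Cp i f : (i <= n)%N -> local_space D i f ->
  Cp p (itvl D i) f.
Proof. by move=> /hECT[+ _]; apply. Qed.

(** A Hermite problem with a single node of multiplicity p+1, for the last space
    of the ECT chain, which is the whole local space. *)
Lemma one_point_interpolation i x (y : nat -> R) : (i <= n)%N -> itvl D i x ->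
  exists2 f, local_space D i f &
    forall l, (l <= p)%N -> deriven_in (itvl D i) l f x = y l.
Proof.
move=> ile Ax; have [_ [u [[Vu _] /(_ ord_max)[_ _ uni]]]] := hECT ile.
have inj1 : injective (fun _ : 'I_1 => x) by move=> a b _; rewrite !ord1.
have [||f [Vf fy _]] := uni 1%N _ (fun=> p.+1) (fun=> y) inj1 (fun=> Ax).
- by [].
- by rewrite big_ord1.
exists f => [|l lp]; last exact: (fy ord0).
rewrite Vu; have [a fE] := Vf; exists a => z Az; rewrite fE //.
by apply: eq_bigr => j _; congr (_ * u _ z); apply: val_inj.
Qed.

(** Splines on the cells lo, ..., hi only: the object that grows by one cell
    at a time. *)
Definition spline_between lo hi (s : nat -> R -> R) : Prop :=
  (forall i, (lo <= i <= hi)%N -> local_space D i (s i)) /\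
  forall i k, (lo < i <= hi)%N -> (k <= smoothness D i)%N ->
    deriven_in (itvl D i.-1) k (s i.-1) (knot D i) =
    deriven_in (itvl D i) k (s i) (knot D i).

(** The new piece copies all derivatives up to order p at the knot, hence those
    up to the required smoothness. *)
Lemma extend_right lo hi s : (lo <= hi)%N -> (hi < n)%N ->
  spline_between lo hi s ->
  exists2 s', spline_between lo hi.+1 s' &
    forall i, (i <= hi)%N -> s' i = s i.
Proof.
move=> lohi hin [sV sm].
have [f fV fE] := one_point_interpolation
  (fun l => deriven_in (itvl D hi) l (s hi) (knot D hi.+1)) hin (itvl_left hin).
exists (fun i => if (i <= hi)%N then s i else f); last by move=> i ->.
split=> [i /andP[loi]|i k /andP[loi]].
  rewrite leq_eqVlt ltnS => /predU1P[->|ihi]; first by rewrite ltnn.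
  by rewrite ihi; apply: sV; rewrite loi.
rewrite leq_eqVlt ltnS => /predU1P[->|ihi] kr.
  rewrite /= leqnn ltnn fE // (leq_trans kr) //; exact: smoothness_le.
by rewrite ihi (leq_trans (leq_pred _)) //; apply: sm; rewrite ?loi.
Qed.

Lemma extend_left lo hi s : (lo < hi)%N -> (hi <= n)%N ->
  spline_between lo.+1 hi s ->
  exists2 s', spline_between lo hi s' &
    forall i, (lo < i)%N -> s' i = s i.
Proof.
move=> lohi hin [sV sm].
have lon : (lo <= n)%N by apply: leq_trans hin; exact: ltnW.
have [f fV fE] := one_point_interpolation
  (fun l => deriven_in (itvl D lo.+1) l (s lo.+1) (knot D lo.+1))
  lon (itvl_right lon).
exists (fun i => if (lo < i)%N then s i else f); last by move=> i ->.
split=> [i /andP[loi ihi]|i k /andP[loi ihi]].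
  have [->|ilo] := eqVneq i lo; first by rewrite ltnn.
  have {}loi : (lo < i)%N by lia.
  by rewrite loi; apply: sV; rewrite loi.
have [-> kr|ilo kr] := eqVneq i lo.+1.
  rewrite /= leqnn ltnn fE // (leq_trans kr) // smoothness_le //=.
  exact: leq_trans lohi hin.
have {}loi : (lo.+1 < i)%N by lia.
have -> : (lo < i)%N by exact: ltnW.
have -> : (lo < i.-1)%N by lia.
by apply: sm => //; rewrite loi.
Qed.

Lemma extend_spline lo hi s : (lo <= hi <= n)%N -> spline_between lo hi s ->
  exists2 s', spline1 D s' & forall i, (lo <= i <= hi)%N -> s' i = s i.
Proof.
move=> /andP[lohi hin] ss.
have [s1 ss1 s1E] : exists2 s', spline_between lo n s' &
    forall i, (i <= hi)%N -> s' i = s i.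
  have [m hm] : exists m, (hi + m = n)%N by exists (n - hi)%N; rewrite subnKC.
  elim: m hi hm lohi hin s ss => [|m IH] hi.
    by rewrite addn0 => -> _ _ s ss; exists s.
  move=> hm lohi hin s ss.
  have hin' : (hi < n)%N by lia.
  have [s' ss' s'E] := extend_right lohi hin' ss.
  have [||s'' ss'' s''E] := IH hi.+1 _ _ hin' s' ss'; [lia|lia|].
  by exists s'' => // i ihi; rewrite s''E ?s'E // ltnW.
have {}hin : (lo <= n)%N by exact: leq_trans lohi hin.
have [s2 ss2 s2E] : exists2 s', spline_between 0 n s' &
    forall i, (lo <= i)%N -> s' i = s1 i.
  elim: lo {ss lohi} hin s1 ss1 {s1E} => [|lo IH] hin s1 ss1; first by exists s1.
  have [s' ss' s'E] := extend_left hin (leqnn _) ss1.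
  have [s'' ss'' s''E] := IH (ltnW hin) s' ss'.
  by exists s'' => // i loi; rewrite s''E ?s'E // ltnW.
by exists s2 => // i /andP[loi ihi]; rewrite s2E // s1E.
Qed.

Lemma extend_piece i f : (i <= n)%N -> local_space D i f ->
  exists2 s, spline1 D s & s i = f.
Proof.
move=> ile fV; have [||s ss sE] := @extend_spline i i (fun=> f).
- by rewrite leqnn.
- by split=> [j|j k]; [rewrite -eqn_leq => /eqP<-|lia].
by exists s; rewrite ?sE ?leqnn.
Qed.

(** The two orders of the cells are treated together, with q the index of the
    common knot, since c' may precede or follow c in each direction. *)
Lemma extend_two_pieces i i' q f g : (i <= n)%N -> (i' <= n)%N ->
  (i' = i.+1 /\ q = i') \/ (i = i'.+1 /\ q = i) ->
  local_space D i f -> local_space D i' g ->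
  (forall k, (k <= smoothness D q)%N ->
    deriven_in (itvl D i) k f (knot D q) = deriven_in (itvl D i') k g (knot D q)) ->
  exists s, [/\ spline1 D s, s i = f & s i' = g].
Proof.
move=> ile i'le adj fV gV fg.
have i'i : (i' == i) = false by apply/eqP; lia.
case: adj fg => -[ii' ->] fg.
- have [||s ss sE] := @extend_spline i i' (fun j => if j == i then f else g).
  + by rewrite ii' leqnSn -ii'.
  + split=> [j ij|j k ij kr].
      by have [->|ji] := eqVneq j i => //; have -> : j = i' by lia.
    have {ij} jE : j = i.+1 by lia.
    by subst j i'; rewrite /= eqxx i'i; exact: fg.
  by exists s; split=> //; rewrite sE ?eqxx ?i'i // ii' leqnSn leqnn.
- have [||s ss sE] := @extend_spline i' i (fun j => if j == i then f else g).
  + by rewrite ii' leqnSn -ii'.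
  + split=> [j ij|j k ij kr].
      by have [->|ji] := eqVneq j i => //; have -> : j = i' by lia.
    have {ij} jE : j = i by lia.
    by subst j i; rewrite /= eqxx i'i; exact/esym/fg.
  by exists s; split=> //; rewrite sE ?eqxx ?i'i // ii' leqnSn leqnn.
Qed.

(** The univariate content of the theorem, in a form that hides whether the two
    cells are equal or adjacent.  The sums are jets expanded at [node t]: for
    adjacent cells [node] is constant equal to the common knot and [E] is the
    beginning of the basis dual to the derivatives there, while for equal cells
    the jet of order 0 at the point itself is the function. *)
Lemma cell_pair_extension i i' :
  (i <= n)%N -> (i' <= n)%N -> (i' <= i.+1)%N -> (i <= i'.+1)%N ->
  exists (N : nat) (node : R -> R) (E : nat -> R -> R),
  [/\ (N <= maxn (smoothness0 D (maxn i i')) (smoothness0 D (minn i i').+1))%N,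
      (N <= p)%N,
      forall t, itvl D i' t -> itvl D i (node t) /\ itvl D i' (node t),
      forall f, local_space D i f -> exists Z, [/\ spline1 D Z, Z i = f &
        forall t, itvl D i' t -> Z i' t =
          \sum_(l < N.+1) deriven_in (itvl D i) l f (node t) * E l t]
    & forall g, local_space D i' g -> exists X Y,
        [/\ spline1 D X, spline1 D Y, X i' = g, Y i = X i &
        forall t, itvl D i' t -> Y i' t =
          \sum_(l < N.+1) deriven_in (itvl D i') l g (node t) * E l t]].
Proof.
move=> ile i'le i'i ii'.
have [eqi|nei] := eqVneq i i'.
  subst i'; exists 0%N, id, (fun _ _ => 1); split=> // f fV.
    have [s ss sE] := extend_piece ile fV.
    by exists s; split=> // t _; rewrite big_ord1 mulr1 sE.
  have [s ss sE] := extend_piece ile fV.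
  by exists s, s; split=> // t _; rewrite big_ord1 mulr1 sE.
pose q := maxn i i'.
have adj : (i' = i.+1 /\ q = i') \/ (i = i'.+1 /\ q = i) by lia.
have qn : (1 <= q <= n)%N by lia.
have [iq i'q] : itvl D i (knot D q) /\ itvl D i' (knot D q).
  by case: adj => -[e ->]; split; do [exact: itvl_left|rewrite e; exact: itvl_right].
have rp : (smoothness D q <= p)%N by exact: smoothness_le.
have /choice[E HE] : forall l : nat, exists f, local_space D i' f /\
    forall k, (k <= p)%N ->
      deriven_in (itvl D i') k f (knot D q) = (k == l)%:R.
  move=> l; have [f fV fE] :=
    one_point_interpolation (fun k => (k == l)%:R) i'le i'q.
  by exists f.
pose N := smoothness D q.
(* [H a] has derivatives a 0, ..., a N at the knot, and then zeros up to p. *)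
pose H (a : nat -> R) t := \sum_(l < N.+1) a l * E l t.
have HV a : local_space D i' (H a).
  by apply: local_space_sum => l; case: (HE l).
have Hjet a k : (k <= N)%N -> deriven_in (itvl D i') k (H a) (knot D q) = a k.
  move=> kN; have kp : (k <= p)%N by exact: leq_trans rp.
  rewrite (@deriven_in_sum _ _ _ (knot_lt i'le) p _ (fun l : 'I_N.+1 => a l)
    (fun l => E l)) // => [|l]; last by apply: local_space_Cp => //; case: (HE l).
  rewrite (bigD1 (Ordinal (kN : (k < N.+1)%N))) //= big1 ?addr0 => [|l lk].
    by have [_ ->//] := HE k; rewrite eqxx mulr1.
  have [_ ->//] := HE l; case: eqP => [kl|]; last by rewrite mulr0.
  by case/eqP: lk; apply: val_inj.
exists N, (fun=> knot D q), E; split=> //.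
- by rewrite /smoothness0 -/q qn leq_maxl.
- move=> f fV; pose a l := deriven_in (itvl D i) l f (knot D q).
  have [|Z [ZS Zi Zi']] := extend_two_pieces ile i'le adj fV (HV a).
    by move=> k kN; rewrite Hjet.
  by exists Z; split=> // t _; rewrite Zi'.
- move=> g gV; have [X XS Xi'] := extend_piece i'le gV.
  pose a l := deriven_in (itvl D i') l g (knot D q).
  (* T g has the jet of g, and g has the jet of [X i] as [X] is a spline. *)
  have Xi : local_space D i (X i) by case: XS => + _; apply.
  have [k kN|Y [YS Yi Yi']] := extend_two_pieces ile i'le adj Xi (HV a).
    rewrite Hjet // /a -Xi'; case: XS => _ Xm.
    by case: adj => -[e qE]; have := Xm q k qn kN; rewrite qE {1 2}e /= => ->.
  by exists X, Y; split=> // t _; rewrite Yi'.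
Qed.

End Univariate.

(** Used in both orders, this says that meeting cells are equal or adjacent. *)
Lemma itvl_meet (R : realType) (D : univariate_data R) i i' x :
  (i' <= nknots D)%N -> itvl D i x -> itvl D i' x -> (i' <= i.+1)%N.
Proof.
rewrite /itvl /= !in_itv /= => i'n /andP[_ xi] /andP[i'x _].
rewrite leqNgt; apply/negP => ii'.
have : knot D i.+1 < knot D i'.
  elim: i' ii' i'n {i'x} => // j IH; rewrite ltnS leq_eqVlt => /predU1P[<-|ij] jn.
    by apply: knot_lt; exact: ltnW.
  by apply: lt_trans (IH ij (ltnW jn)) (knot_lt _); exact: ltnW.
by rewrite ltNge (le_trans i'x).
Qed.

(** * Mixed partial derivatives of tensor products *)

Section Multivariate.
Variables (R : realType) (d : nat) (D : 'I_d -> univariate_data R).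
Variable c : cell D.
Local Notation I j := (itvl (D j) (c j)).

(** Moving along the j0-th axis inside the box, the other factors of each
    product are constants, so the slice is a linear combination of the j0-th
    factors. *)
Lemma partial_in_tensor (j0 : 'I_d) m (v : 'I_m -> 'I_d -> R -> R)
    (F : 'rV[R]_d -> R) (x : 'rV[R]_d) :
  (forall y, box c y -> F y = \sum_k \prod_j v k j (y ord0 j)) ->
  (forall k, derivable_in (I j0) (v k j0) (x ord0 j0) 1) -> box c x ->
  partial_in (box c) j0 F x = \sum_k \prod_j
    (if j == j0 then derive_in (I j) (v k j) (x ord0 j) 1
     else v k j (x ord0 j)).
Proof.
move=> FE vd Bx.
pose b k := \prod_(j | j != j0) v k j (x ord0 j).
have step h j : (h *: delta_mx ord0 j0 + x) ord0 j =
    if j == j0 then h *: 1 + x ord0 j else x ord0 j.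
  by rewrite !mxE eqxx /=; case: eqP => _; rewrite /GRing.scale //= mulr0 add0r.
(* [x] being in the box, only the j0-th coordinate can leave it. *)
have stepB h : box c (h *: delta_mx ord0 j0 + x) <-> I j0 (h *: 1 + x ord0 j0).
  split=> [/(_ j0)|Bh j]; rewrite step ?eqxx //.
  by case: eqP => [->|_] //; exact: Bx.
have lt0 : knot (D j0) (c j0) < knot (D j0) (c j0).+1.
  by apply: knot_lt; rewrite -ltnS.
rewrite /partial_in (@derive_in_transfer _ _ _ _ (I j0) F
  (fun t => \sum_k b k * v k j0 t) x _ (x ord0 j0) 1) //.
- rewrite (@derive_in_sum _ _ _ lt0 _ b (fun k => v k j0) _ _ (Bx j0)) //.
  apply: eq_bigr => k _; rewrite [RHS](bigD1 j0) //= eqxx mulrC; congr (_ * _).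
  by apply: eq_bigr => j /negPf ->.
- move=> h Bh; rewrite FE //; apply: eq_bigr => k _.
  rewrite (bigD1 j0) //= step eqxx mulrC; congr (_ * _).
  by apply: eq_bigr => j /negPf jj0; rewrite step jj0.
- by rewrite FE //; apply: eq_bigr => k _; rewrite (bigD1 j0) //= mulrC.
Qed.

Lemma mpartial_in_tensor m (w : 'I_m -> 'I_d -> R -> R)
    (F : 'rV[R]_d -> R) (e : 'I_d -> nat) (x : 'rV[R]_d) :
  (forall k j, Cp (degree (D j)) (I j) (w k j)) ->
  (forall j, (e j <= degree (D j))%N) ->
  (forall y, box c y -> F y = \sum_k \prod_j w k j (y ord0 j)) ->
  box c x -> mpartial_in (box c) e F x =
    \sum_k \prod_j deriven_in (I j) (e j) (w k j) (x ord0 j).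
Proof.
move=> wC ep FE Bx; rewrite /mpartial_in.
(* For directions not yet differentiated the order is 0; the induction over
   the list is needed at all points of the box, as the next derivative uses
   nearby values. *)
have H (s : seq 'I_d) y : uniq s -> box c y ->
    foldr (fun j => iter (e j) (partial_in (box c) j)) F s y =
    \sum_k \prod_j deriven_in (I j) (if j \in s then e j else 0%N)
      (w k j) (y ord0 j).
  elim: s y => [|j0 s IH] y; first by move=> _ /FE.
  move=> /= /andP[j0s us].
  have iterE N z : (N <= e j0)%N -> box c z ->
      iter N (partial_in (box c) j0) (foldr (fun j =>
        iter (e j) (partial_in (box c) j)) F s) z =
      \sum_k \prod_j deriven_in (I j)
        (if j == j0 then N else if j \in s then e j else 0%N) (w k j) (z ord0 j).
    elim: N z => [|N IHN] z Ne Bz /=.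
      rewrite IH //; apply: eq_bigr => k _; apply: eq_bigr => j _.
      by case: eqP => // ->; rewrite (negPf j0s).
    rewrite (@partial_in_tensor _ _ (fun k j => deriven_in (I j)
        (if j == j0 then N else if j \in s then e j else 0%N) (w k j))) //.
    - apply: eq_bigr => k _; apply: eq_bigr => j _.
      by case: eqP => // ->.
    - by move=> z' Bz'; rewrite IHN // ltnW.
    - move=> k; rewrite eqxx; case: (wC k j0) => + _; apply => //.
      exact: leq_trans (ep j0).
  move=> By; rewrite iterE //; apply: eq_bigr => k _; apply: eq_bigr => j _.
  by rewrite inE; case: eqP => // ->.
rewrite H ?enum_uniq //; apply: eq_bigr => k _; apply: eq_bigr => j _.
by rewrite mem_enum.
Qed.

End Multivariate.
(** * The tensor-product spline space *)

Lemma spline1_opp (R : realType) (D : univariate_data R) s :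
  (forall i, (i <= nknots D)%N ->
    ECT_space (degree D) (itvl D i) (local_space D i)) ->
  spline1 D s -> spline1 D (fun i x => - s i x).
Proof.
move=> hECT [sV sm].
have oppE i : (fun x => - s i x) = (fun x => \sum_(k < 1) -1 * s i x).
  by apply/funext => x; rewrite big_ord1 mulN1r.
have derE i k x : (i <= nknots D)%N -> (k <= degree D)%N -> itvl D i x ->
    deriven_in (itvl D i) k (fun x => - s i x) x =
    - deriven_in (itvl D i) k (s i) x.
  move=> ile kp Ax; rewrite oppE.
  rewrite (@deriven_in_sum _ _ _ (knot_lt ile) _ _ (fun _ : 'I_1 => -1)
    (fun=> s i) _ _ _ kp Ax) // => [|_].
    by rewrite big_ord1 mulN1r.
  by apply: (local_space_Cp hECT) => //; exact: sV.
split=> [i ile|i k ib kr].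
  by rewrite oppE; apply: local_space_sum => _; exact: sV.
have kp : (k <= degree D)%N by exact: leq_trans (smoothness_le ib).
case: i ib kr => // i ib kr /=; have lein : (i <= nknots D)%N by exact: ltnW.
by rewrite !derE //; [rewrite -(sm i.+1)|exact: itvl_left|exact: itvl_right].
Qed.

Section TensorSpline.
Variables (R : realType) (d : nat) (D : 'I_d -> univariate_data R).

Lemma tensor_splineD s s' : tensor_spline s -> tensor_spline s' ->
  tensor_spline (fun (c : cell D) x => s c x + s' c x).
Proof.
move=> [m [w [wS wE]]] [m' [w' [w'S w'E]]].
exists (m + m')%N, (fun k => match fintype.split k with
  inl a => w a | inr b => w' b end).
split=> [k j|c x Bx]; first by case: fintype.split.
rewrite big_split_ord wE // w'E //; congr (_ + _); apply: eq_bigr => k _.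
  by rewrite -[lshift _ _]/(unsplit (inl k)) unsplitK.
by rewrite -[rshift _ _]/(unsplit (inr k)) unsplitK.
Qed.

(** The sign is absorbed in one factor of each product, whence the need of a
    direction. *)
Lemma tensor_spline_opp s : (0 < d)%N ->
  (forall (j : 'I_d) (i : nat), (i <= nknots (D j))%N ->
    ECT_space (degree (D j)) (itvl (D j) i) (local_space (D j) i)) ->
  tensor_spline s -> tensor_spline (fun (c : cell D) x => - s c x).
Proof.
move=> d_gt0 hECT [m [w [wS wE]]]; have j0 : 'I_d := Ordinal d_gt0.
exists m, (fun k j => if j == j0 then fun i x => - w k j i x else w k j).
split=> [k j|c x Bx].
  by case: eqP => _ //; apply: spline1_opp => //; exact: hECT.
rewrite wE // -sumrN; apply: eq_bigr => k _.
rewrite (bigD1 j0) //= [in RHS](bigD1 j0) //= eqxx mulNr.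
by congr (- (_ * _)); apply: eq_bigr => j /negPf ->.
Qed.

End TensorSpline.

(** * Assembly *)

(** Multiplying out, both sides are the same combination of the sums of products
    with one fixed order in each direction. *)
Lemma eq_sum_prod_sum (R : comNzRingType) d m m' (N : 'I_d -> nat)
    (a : 'I_m -> 'I_d -> nat -> R) (a' : 'I_m' -> 'I_d -> nat -> R)
    (E : 'I_d -> nat -> R) :
  (forall e : 'I_d -> nat, (forall j, (e j <= N j)%N) ->
    \sum_k \prod_j a k j (e j) = \sum_k \prod_j a' k j (e j)) ->
  \sum_k \prod_j \sum_(l < (N j).+1) a k j l * E j l =
  \sum_k \prod_j \sum_(l < (N j).+1) a' k j l * E j l.
Proof.
(* A common bound M lets all the inner sums range over the same type. *)
move=> aa'; pose M := (\max_j N j).+1.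
have NM j : ((N j).+1 <= M)%N by rewrite ltnS leq_bigmax.
have expand q (b : 'I_q -> 'I_d -> nat -> R) :
    \sum_k \prod_j \sum_(l < (N j).+1) b k j l * E j l =
    \sum_(f in family (fun j (l : 'I_M) => (l < (N j).+1)%N))
      (\sum_k \prod_j b k j (f j)) * \prod_j E j (f j).
  under eq_bigr => k _.
    under eq_bigr => j _ do
      rewrite (big_ord_widen M (fun l => b k j l * E j l) (NM j)).
    rewrite bigA_distr_big_dep.
    under eq_bigr => f _ do rewrite big_split /=.
    over.
  rewrite exchange_big; apply: eq_bigr => f _ /=.
  by rewrite mulr_suml.
rewrite !expand; apply: eq_bigr => f /familyP fN; congr (_ * _).
by apply: aa' => j; exact: fN.
Qed.

Theorem theorem3p17 (R : realType) (d : nat) (D : 'I_d -> univariate_data R)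
    (d_gt0 : (0 < d)%N)
    (hECT : forall (j : 'I_d) (i : nat), (i <= nknots (D j))%N ->
      ECT_space (degree (D j)) (itvl (D j) i) (local_space (D j) i))
    (c c' : cell D) (hcc' : c <> c') (hmeet : box c `&` box c' !=set0)
    (u u' : 'rV[R]_d -> R) (hu : cell_space c u) (hu' : cell_space c' u')
    (hcontact : contact c c' u u') :
  exists s : cell D -> 'rV[R]_d -> R,
    [/\ tensor_spline s,
        forall x, box c x -> s c x = u x
      & forall x, box c' x -> s c' x = u' x].
Proof.
have [m [w [wV uE]]] := hu; have [m' [w' [w'V u'E]]] := hu'.
have le_n (b : cell D) j : (b j <= nknots (D j))%N by rewrite -ltnS.
have [z [Bz B'z]] := hmeet.
have /choice[N /choice[node /choice[E ext]]] := fun j =>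
  cell_pair_extension (hECT j) (le_n c j) (le_n c' j)
    (itvl_meet (le_n c' j) (Bz j) (B'z j))
    (itvl_meet (le_n c j) (B'z j) (Bz j)).
have /choice[Z ZP] : forall kj : 'I_m * 'I_d, exists Z,
    [/\ spline1 (D kj.2) Z, Z (c kj.2) = w kj.1 kj.2 &
      forall t, itvl (D kj.2) (c' kj.2) t -> Z (c' kj.2) t =
        \sum_(l < (N kj.2).+1) deriven_in (itvl (D kj.2) (c kj.2)) l
          (w kj.1 kj.2) (node kj.2 t) * E kj.2 l t].
  by case=> k j /=; case: (ext j) => _ _ _ + _; apply; exact: wV.
have /choice[X /choice[Y XYP]] : forall kj : 'I_m' * 'I_d, exists X Y,
    [/\ spline1 (D kj.2) X, spline1 (D kj.2) Y, X (c' kj.2) = w' kj.1 kj.2,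
      Y (c kj.2) = X (c kj.2) &
      forall t, itvl (D kj.2) (c' kj.2) t -> Y (c' kj.2) t =
        \sum_(l < (N kj.2).+1) deriven_in (itvl (D kj.2) (c' kj.2)) l
          (w' kj.1 kj.2) (node kj.2 t) * E kj.2 l t].
  by case=> k j /=; case: (ext j) => _ _ _ _; apply; exact: w'V.
exists (fun b x => \sum_k \prod_j Z (k, j) (b j) (x ord0 j) +
  (\sum_k \prod_j X (k, j) (b j) (x ord0 j) +
   - \sum_k \prod_j Y (k, j) (b j) (x ord0 j))); split.
- apply: tensor_splineD; last apply: tensor_splineD.
  + by exists m, (fun k j => Z (k, j)); split=> // k j; case: (ZP (k, j)).
  + by exists m', (fun k j => X (k, j)); split=> // k j; case: (XYP (k, j)).
  + apply: tensor_spline_opp => //.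
    by exists m', (fun k j => Y (k, j)); split=> // k j; case: (XYP (k, j)).
- move=> x Bx; rewrite uE //.
  under [in X in _ + (_ - X)]eq_bigr => k _.
    under eq_bigr => j _ do [case: (XYP (k, j)) => /= _ _ _ -> _].
    over.
  rewrite subrr addr0; apply: eq_bigr => k _; apply: eq_bigr => j _.
  by case: (ZP (k, j)) => /= _ ->.
- move=> x B'x; rewrite u'E //.
  have -> : \sum_k \prod_j X (k, j) (c' j) (x ord0 j) =
      \sum_k \prod_j w' k j (x ord0 j).
    apply: eq_bigr => k _; apply: eq_bigr => j _.
    by case: (XYP (k, j)) => /= _ _ ->.
  (* What is left is that the T f and the T g have the same tensor sum. *)
  rewrite addrCA -[RHS]addr0; congr (_ + _); apply/eqP; rewrite subr_eq0.
  apply/eqP.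
  transitivity (\sum_k \prod_j \sum_(l < (N j).+1)
      deriven_in (itvl (D j) (c j)) l (w k j) (node j (x ord0 j)) *
      E j l (x ord0 j)).
    apply: eq_bigr => k _; apply: eq_bigr => j _.
    by case: (ZP (k, j)) => /= _ _ ->.
  transitivity (\sum_k \prod_j \sum_(l < (N j).+1)
      deriven_in (itvl (D j) (c' j)) l (w' k j) (node j (x ord0 j)) *
      E j l (x ord0 j)); last first.
    apply: eq_bigr => k _; apply: eq_bigr => j _.
    by case: (XYP (k, j)) => /= _ _ _ _ ->.
  apply: (@eq_sum_prod_sum _ _ _ _ _
    (fun k j l => deriven_in (itvl (D j) (c j)) l (w k j) (node j (x ord0 j)))
    (fun k j l => deriven_in (itvl (D j) (c' j)) l (w' k j) (node j (x ord0 j)))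
    (fun j l => E j l (x ord0 j))) => e eN.
  pose y : 'rV[R]_d := \row_j node j (x ord0 j).
  have [By B'y] : box c y /\ box c' y.
    by split=> j; rewrite mxE; case: (ext j) => _ _ /(_ _ (B'x j))[].
  have ep j : (e j <= degree (D j))%N.
    by case: (ext j) => _ + _ _ _; exact: leq_trans.
  have : mpartial_in (box c) e u y = mpartial_in (box c') e u' y.
    apply: hcontact => [j|//]; case: (ext j) => + _ _ _ _.
    exact: leq_trans.
  rewrite (mpartial_in_tensor _ ep uE) //; last first.
    by move=> k j; exact: (local_space_Cp (hECT j)).
  rewrite (mpartial_in_tensor _ ep u'E) //; last first.
    by move=> k j; exact: (local_space_Cp (hECT j)).
  under eq_bigr => k _ do under eq_bigr => j _ do rewrite mxE.
  move=> ->; apply: eq_bigr => k _; apply: eq_bigr => j _.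
  by rewrite mxE.
Qed.
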